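(* Let $K$ be a field of characteristic $0$ and let $n\ge 2$, $m\ge 1$, $k\ge 2$ be integers. Let $f\in K[x_1,\dots,x_n]$ be a polynomial in which $x_1$ actually occurs, and let $$p_1=p_1(x_1,\dots,x_n)=x_1-f(x_1^k,x_2,\dots,x_n).$$ Let $p_i=p_i(x_2,\dots,x_n)\in K[x_2,\dots,x_n]$ for $2\le i\le m$. Suppose that, for some pure lexicographic order, every polynomial in the Gröbner basis (with respect to this order) of the ideal $\langle p_1,\dots,p_m\rangle$ of $K[x_1,\dots,x_n]$ has highest monomial of the form $x_1^{k_1}\cdots x_n^{k_n}$ with all $k_i>0$. Then the isomorphism $$\varphi:\ K[x_1,\dots,x_n]/\langle x_1-f^k(x_1,x_2,\dots,x_n),\,p_2,\dots,p_m\rangle\ \longrightarrow\ K[x_1,\dots,x_n]/\langle p_1,\dots,p_m\rangle$$ given by $x_1\mapsto x_1^k$, $x_i\mapsto x_i$ for $i\ge 2$, cannot be lifted to an automorphism of $K[x_1,\dots,x_n]$.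
   Context: $\langle q_1,\dots,q_r\rangle$ denotes the ideal of $K[x_1,\dots,x_n]$ generated by $q_1,\dots,q_r$. $f(x_1^k,x_2,\dots,x_n)$ is the result of substituting $x_1^k$ for $x_1$ in $f$, and $f^k(x_1,\dots,x_n)$ is the $k$-th power of $f(x_1,\dots,x_n)$. A pure lexicographic order on the set of monomials in $x_1,\dots,x_n$ is the one induced by an order $x_{i_1}<\dots<x_{i_n}$ on the set of variables (so that, for example, $x_{i_1}^k<x_{i_n}$ for any $k$). The Gröbner basis is the reduced Gröbner basis. An isomorphism $\varphi: K[x_1,\dots,x_n]/I\to K[x_1,\dots,x_n]/J$ of $K$-algebras can be lifted to an automorphism of $K[x_1,\dots,x_n]$ if there is a $K$-algebra automorphism $\Phi$ of $K[x_1,\dots,x_n]$ inducing $\varphi$, i.e. $\Phi(g)+J=\varphi(g+I)$ for all $g\in K[x_1,\dots,x_n]$. *)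

(* Defs.v *)
From HB Require Import structures.
From mathcomp Require Import all_boot all_order all_algebra all_fingroup.
From mathcomp Require Import generic_quotient ring_quotient.
From mathcomp Require Import boolp.
From mathcomp Require Export mpoly.

Set Implicit Arguments.
Unset Strict Implicit.
Unset Printing Implicit Defensive.

Import GRing.Theory.
Local Open Scope ring_scope.
Local Open Scope quotient_scope.

Section Ideal.
Variables (K : fieldType) (A : comAlgType K) (s : seq A).

Definition ideal_gen : {pred A} :=
  fun x => `[< exists c : 'I_(size s) -> A, x = \sum_i c i * s`_i >].

Lemma ideal_genP x :
  reflect (exists c : 'I_(size s) -> A, x = \sum_i c i * s`_i)
          (x \in ideal_gen).
Proof. exact: asboolP. Qed.

Fact ideal_gen_zmod_closed : zmod_closed ideal_gen.
Proof.
split=> [|x y /ideal_genP[c ->] /ideal_genP[d ->]]; apply/ideal_genP.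
  by exists (fun=> 0); rewrite big1 // => i _; rewrite mul0r.
exists (fun i => c i - d i); rewrite -sumrB.
by apply: eq_bigr => i _; rewrite mulrBl.
Qed.

HB.instance Definition _ :=
  GRing.isZmodClosed.Build A ideal_gen ideal_gen_zmod_closed.

Lemma ideal_genMr a x : x \in ideal_gen -> a * x \in ideal_gen.
Proof.
move=> /ideal_genP[c ->]; apply/ideal_genP; exists (fun i => a * c i).
by rewrite mulr_sumr; apply: eq_bigr => i _; rewrite mulrA.
Qed.

(* [ring_quotient] equips [{ideal_quot I}] with a ring structure for proper
   ideals only; here the ideal may be the whole ring, so that the quotient is
   a [comPzRingType] and an [lmodType K] (with [scale_quotAl] below), possibly
   the zero algebra. *)
Definition quot_alg := {ideal_quot ideal_gen}.

HB.instance Definition _ := GRing.Zmodule.on quot_alg.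
HB.instance Definition _ := EqQuotient.on quot_alg.

Definition quot_pi (x : A) : quot_alg := \pi_quot_alg x.

Definition quot_one : quot_alg := quot_pi 1.
Definition quot_mul (u v : quot_alg) : quot_alg := quot_pi (repr u * repr v).
Definition quot_scale (a : K) (u : quot_alg) : quot_alg := quot_pi (a *: repr u).

Lemma quot_piK (u : quot_alg) : quot_pi (repr u) = u.
Proof. exact: reprK. Qed.

Lemma quot_piW (P : quot_alg -> Prop) :
  (forall x, P (quot_pi x)) -> forall u, P u.
Proof. by move=> Ppi u; rewrite -[u]quot_piK. Qed.

Lemma pi_quotP x y :
  reflect (quot_pi x = quot_pi y) (x - y \in ideal_gen).
Proof. by rewrite Quotient.idealrBE; apply: eqP. Qed.

Lemma pi_quotD x y : quot_pi (x + y) = quot_pi x + quot_pi y.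
Proof. by rewrite /quot_pi piE. Qed.

Lemma pi_quotM x y :
  quot_pi (x * y) = quot_mul (quot_pi x) (quot_pi y).
Proof.
apply/pi_quotP; set x' := repr _; set y' := repr _.
have -> : x * y - x' * y' = y * (x - x') + x' * (y - y').
  by rewrite !mulrBr addrA [y * x]mulrC [y * x']mulrC subrK.
by rewrite rpredD // ideal_genMr //; apply/pi_quotP; rewrite quot_piK.
Qed.

Lemma pi_quotZ a x :
  quot_pi (a *: x) = quot_scale a (quot_pi x).
Proof.
apply/pi_quotP; rewrite -scalerBr -mulr_algl ideal_genMr //.
by apply/pi_quotP; rewrite quot_piK.
Qed.

Fact quot_mulA : associative quot_mul.
Proof.
by elim/quot_piW=> x; elim/quot_piW=> y; elim/quot_piW=> z; rewrite -!pi_quotM mulrA.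
Qed.

Fact quot_mulC : commutative quot_mul.
Proof. by elim/quot_piW=> x; elim/quot_piW=> y; rewrite -!pi_quotM mulrC. Qed.

Fact quot_mul1 : left_id quot_one quot_mul.
Proof. by elim/quot_piW=> x; rewrite -pi_quotM mul1r. Qed.

Fact quot_mulDl : left_distributive quot_mul +%R.
Proof.
elim/quot_piW=> x; elim/quot_piW=> y; elim/quot_piW=> z.
by rewrite -pi_quotD -!pi_quotM mulrDl pi_quotD.
Qed.

HB.instance Definition _ := GRing.Zmodule_isComPzRing.Build quot_alg
  quot_mulA quot_mulC quot_mul1 quot_mulDl.

Fact quot_scaleA a b u :
  quot_scale a (quot_scale b u) = quot_scale (a * b) u.
Proof. by elim/quot_piW: u => x; rewrite -!pi_quotZ scalerA. Qed.

Fact quot_scale1 : left_id 1 quot_scale.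
Proof. by elim/quot_piW=> x; rewrite -pi_quotZ scale1r. Qed.

Fact quot_scaleDr : right_distributive quot_scale +%R.
Proof.
move=> a; elim/quot_piW=> x; elim/quot_piW=> y.
by rewrite -pi_quotD -!pi_quotZ scalerDr pi_quotD.
Qed.

Fact quot_scaleDl u : {morph quot_scale^~ u : a b / a + b}.
Proof.
by elim/quot_piW: u => x a b; rewrite -!pi_quotZ scalerDl pi_quotD.
Qed.

HB.instance Definition _ := GRing.Zmodule_isLmodule.Build K quot_alg
  quot_scaleA quot_scale1 quot_scaleDr quot_scaleDl.

Lemma scale_quotAl (a : K) (u v : quot_alg) : a *: (u * v) = a *: u * v.
Proof.
elim/quot_piW: u => x; elim/quot_piW: v => y.
by rewrite /GRing.scale /GRing.mul /= -!(pi_quotM, pi_quotZ) scalerAl.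
Qed.

End Ideal.

Section Lift.
Variables (K : fieldType) (A : comAlgType K) (s t : seq A).

Definition alg_isomorphism (phi : {rmorphism quot_alg s -> quot_alg t}) : Prop :=
  scalable phi /\ bijective phi.

Definition lifts_to_automorphism (phi : quot_alg s -> quot_alg t) : Prop :=
  exists Phi : {lrmorphism A -> A},
    bijective Phi /\ forall g, quot_pi t (Phi g) = phi (quot_pi s g).

End Lift.

Section Monomials.
Variables (K : fieldType) (n : nat).
Implicit Types (p q : {mpoly K[n]}) (m : 'X_{1..n}) (s : 'S_n).

Definition var_occurs (i : 'I_n) p : bool := has (fun m => 0 < m i)%N (msupp p).

(* f(x_1, ..., x_i ^ k, ..., x_n) *)
Definition subst_pow (i : 'I_n) (k : nat) p : {mpoly K[n]} :=
  p \mPo [tuple if j == i then 'X_j ^+ k else 'X_j | j < n].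

(* The pure lexicographic order induced by 'X_(s 0) < 'X_(s 1) < ... :
   monomials are compared at the largest variable where they differ. *)
Definition lex_lt s m1 m2 : bool :=
  [exists i : 'I_n, (m1 (s i) < m2 (s i))%N &&
    [forall j : 'I_n, (i < j)%N ==> (m1 (s j) == m2 (s j))]].

Definition lex_max s m1 m2 := if lex_lt s m1 m2 then m2 else m1.

(* 0 is the least monomial, so this is the highest monomial of p when p != 0;
   it defaults to 0 when p = 0, as [mlead] does. *)
Definition lex_lead s p : 'X_{1..n} :=
  \big[lex_max s/0%MM]_(m <- msupp p) m.

Definition is_groebner_basis s (I : {pred {mpoly K[n]}}) (G : seq {mpoly K[n]}) :
    Prop :=
  [/\ {subset G <= I}, 0 \notin G
    & forall q, q \in I -> q != 0 ->
        exists2 g, g \in G & (lex_lead s g <= lex_lead s q)%MM].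

Definition is_reduced_groebner_basis s (I : {pred {mpoly K[n]}})
    (G : seq {mpoly K[n]}) : Prop :=
  [/\ is_groebner_basis s I G,
      forall g, g \in G -> g@_(lex_lead s g) = 1
    & forall g h m, g \in G -> h \in G -> h != g -> m \in msupp g ->
        ~~ (lex_lead s h <= m)%MM].

End Monomials.

(* Main.v *)
From HB Require Import structures.
Require Import Defs.
From mathcomp Require Import all_boot all_order all_algebra all_fingroup.
From mathcomp Require Import mpoly ring.
From mathcomp Require boolp.

(** Let alpha be the substitution x1 |-> x1 ^ k and beta the substitution
    x1 |-> f.  Modulo J one has x1 = alpha f and modulo I one has x1 = f ^ k,
    so alpha and beta induce mutually inverse maps between the quotients:
    the isomorphism phi is the one induced by alpha.

    Suppose that an automorphism Phi lifts phi, so that Phi x1 = x1 ^ k + r1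
    and Phi x_i = x_i + r_i for i <> x1, with all r_i in J.  The hypothesis on
    the Groebner basis says that every nonzero element of J has a full leading
    monomial, that is, one in which all variables occur.

    The heart of the proof is that Phi x_i never has a full leading monomial
    ([automorphism_var_lead]).  Indeed, for j <> i, the derivation
    D = Phi o d/dx_j o Phi^-1 is nonzero, locally nilpotent and kills Phi x_i,
    and no nonzero p with D p = 0 has a full leading monomial when D is such a
    derivation ([nilpotent_derivation_lead]).  For the latter, take the
    homogeneous part of D of highest degree for the grading by lexicographic
    exponents: it sends x^a to (c . a) x^(a + delta) for a fixed nonzero vector
    c over K.  As D is locally nilpotent, for each l the sequence
    c_l, c_l + mu, c_l + 2 mu, ... with mu = c . delta reaches 0, so that c_l
    is a natural multiple t_l of - mu.  If x^a is the leading monomial of p,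
    D p = 0 gives c . a = 0, hence sum_l a_l t_l = 0 in characteristic 0,
    and a_l = 0 for any l with t_l <> 0.

    If r_i is nonzero for some i <> x1, its leading monomial is full, hence
    exceeds x_i and is the leading monomial of Phi x_i, which is impossible.
    So Phi fixes every variable but x1, and d/dx1 (Phi x1) is a nonzero
    constant ([automorphism_fixing_vars]).  Then d/dx1 r1 = const - k x1 ^ (k - 1)
    is nonzero and involves x1 only, whereas the derivative of the leading term
    of r1 contains all the other variables. *)

Set Implicit Arguments.
Unset Strict Implicit.
Unset Printing Implicit Defensive.

Import GRing.Theory.
Local Open Scope ring_scope.

(** * The lexicographic order on monomials *)

Section LexOrder.
Variables (n : nat) (s : 'S_n).
Implicit Types (a b c : 'X_{1..n}).

Definition lex_le a b := (a == b) || lex_lt s a b.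

Lemma lex_ltP a b :
  reflect (exists2 i : 'I_n, (a (s i) < b (s i))%N
             & forall j : 'I_n, (i < j)%N -> a (s j) = b (s j))
          (lex_lt s a b).
Proof.
apply: (iffP existsP) => [[i /andP[lti /forallP eqj]]|[i lti eqj]]; exists i.
  by [].
  by move=> j ltij; apply/eqP; move: (eqj j); rewrite ltij.
by rewrite lti; apply/forallP => j; apply/implyP => /eqj ->.
Qed.

Lemma lex_lt_irr a : lex_lt s a a = false.
Proof. by apply/lex_ltP => -[i]; rewrite ltnn. Qed.

Lemma lex_lt_trans b a c : lex_lt s a b -> lex_lt s b c -> lex_lt s a c.
Proof.
move=> /lex_ltP[i lti eqi] /lex_ltP[j ltj eqj]; apply/lex_ltP.
case: (ltngtP i j) => [ltij|ltji|/val_inj eij].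
- exists j => [|l ltjl]; first by rewrite eqi.
  by rewrite eqi ?eqj // (ltn_trans ltij).
- exists i => [|l ltil]; first by rewrite -eqj.
  by rewrite eqi ?eqj // (ltn_trans ltji).
- exists i => [|l ltil]; first by rewrite (ltn_trans lti) // eij.
  by rewrite eqi ?eqj // -eij.
Qed.

Lemma lex_le_total a b : lex_le a b || lex_lt s b a.
Proof.
rewrite /lex_le; case: eqP => //= neq_ab.
(* The largest variable at which a and b differ decides. *)
have [i0 ne0] : exists i, a (s i) != b (s i).
  apply/existsP; apply: contra_notT neq_ab; rewrite negb_exists => /forallP eqab.
  by apply/mnmP => i; apply/eqP; move: (eqab (s^-1%g i)); rewrite permKV negbK.
case: (@arg_maxnP _ i0 (fun i => a (s i) != b (s i)) val ne0) => i nei maxi.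
have eqj (j : 'I_n) : (i < j)%N -> a (s j) = b (s j).
  by move=> ltij; apply/eqP; apply: contraTT ltij => /maxi; rewrite -leqNgt.
case: (ltngtP (a (s i)) (b (s i))) nei => // ltab _; apply/orP; [left|right].
  by apply/lex_ltP; exists i.
by apply/lex_ltP; exists i => // j /eqj.
Qed.

Lemma lex_lt_le_trans b a c : lex_lt s a b -> lex_le b c -> lex_lt s a c.
Proof. by move=> ab /orP[/eqP<-//|]; apply: lex_lt_trans. Qed.

Lemma lex_le_trans b a c : lex_le a b -> lex_le b c -> lex_le a c.
Proof.
move=> /orP[/eqP->//|ab bc].
by rewrite /lex_le (lex_lt_le_trans ab bc) orbT.
Qed.

Lemma lex_le_anti a b : lex_le a b -> lex_le b a -> a = b.
Proof.
by move=> /orP[/eqP//|ab] /(lex_lt_le_trans ab); rewrite lex_lt_irr.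
Qed.

Lemma lex_leD2r c a b : lex_le a b -> lex_le (a + c)%MM (b + c)%MM.
Proof.
move=> /orP[/eqP->|/lex_ltP[i lti eqi]]; first by rewrite /lex_le eqxx.
apply/orP; right; apply/lex_ltP; exists i => [|j ltij].
  by rewrite !mnmDE ltn_add2r.
by rewrite !mnmDE eqi.
Qed.

Lemma lex_leD a b a' b' :
  lex_le a a' -> lex_le b b' -> lex_le (a + b)%MM (a' + b')%MM.
Proof.
move=> la lb; apply: (lex_le_trans (lex_leD2r b la)).
by rewrite ![(a' + _)%MM]addmC; apply: lex_leD2r.
Qed.

(** This makes a product of two leading terms a term that no other pair of
    terms can cancel. *)
Lemma lex_leD_eq a b a' b' :
  lex_le a a' -> lex_le b b' -> (a + b = a' + b')%MM -> a = a' /\ b = b'.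
Proof.
move=> la lb eqab.
have eqb : (a' + b = a' + b')%MM.
  apply: lex_le_anti; first by apply: lex_leD => //; rewrite /lex_le eqxx.
  by rewrite -eqab; apply: lex_leD2r.
have eb : b = b' by rewrite -[b](addmK a') addmC eqb addmC addmK.
by split=> //; rewrite -[a](addmK b) eqab eb addmK.
Qed.

Lemma lex_le0 a : lex_le 0%MM a.
Proof.
case/orP: (lex_le_total 0%MM a) => // /lex_ltP[i]; first by rewrite mnm0E.
Qed.

Lemma mnm_le_lex_le a b : (a <= b)%MM -> lex_le a b.
Proof.
by move=> /submK <-; rewrite -{1}[a]add0m; apply/lex_leD2r/lex_le0.
Qed.

Let bigmax (r : seq 'X_{1..n}) := \big[lex_max s/0%MM]_(m <- r) m.

Lemma lex_bigmax_ge r a : a \in r -> lex_le a (bigmax r).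
Proof.
elim: r => // b r IHr; rewrite /bigmax big_cons inE -/(bigmax r) /lex_max.
case/orP: (lex_le_total (bigmax r) b) => [le_rb|lt_br].
  have -> : (if lex_lt s b (bigmax r) then bigmax r else b) = b.
    case: ifP => // /lex_lt_le_trans/(_ le_rb); by rewrite lex_lt_irr.
  case/predU1P=> [->|/IHr]; first by rewrite /lex_le eqxx.
  by move=> ar; apply: lex_le_trans le_rb.
by rewrite lt_br; case/predU1P=> [->|/IHr//]; rewrite /lex_le lt_br orbT.
Qed.

Lemma lex_bigmax_mem r : r != [::] -> bigmax r \in r.
Proof.
elim: r => // b r IHr _; rewrite /bigmax big_cons inE -/(bigmax r) /lex_max.
case: ifP => lt_br; last by rewrite eqxx.
have [r0|/IHr ->] := eqVneq r [::]; last by rewrite orbT.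
move: lt_br; rewrite r0 /bigmax big_nil => /lex_lt_le_trans/(_ (lex_le0 b)).
by rewrite lex_lt_irr.
Qed.

End LexOrder.

(** * Leading monomials of sums and products *)

Section LeadingMonomials.
Variables (K : fieldType) (n : nat) (s : 'S_n).
Implicit Types (p q : {mpoly K[n]}) (a b : 'X_{1..n}).

(** The bound need not be attained: the coefficient of p at a may be 0, which
    lets sums be bounded termwise even when leading terms cancel. *)
Definition lex_bounded p a := forall m, m \in msupp p -> lex_le s m a.

Definition lex_leads p a := lex_bounded p a /\ p@_a != 0.

Lemma lex_leads_lead p : p != 0 -> lex_leads p (lex_lead s p).
Proof.
move=> p0; split=> [m|]; first exact: lex_bigmax_ge.
by rewrite -mcoeff_msupp lex_bigmax_mem // msupp_eq0.
Qed.

Lemma lex_leads_uniq p a b : lex_leads p a -> lex_leads p b -> a = b.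
Proof.
move=> [pa ca] [pb cb]; apply: (@lex_le_anti _ s).
  by apply: pb; rewrite mcoeff_msupp.
by apply: pa; rewrite mcoeff_msupp.
Qed.

Lemma lex_boundedX a : lex_bounded 'X_[a] a.
Proof. by move=> m; rewrite msuppX inE /lex_le => ->. Qed.

Lemma lex_bounded_sum (I : finType) (F : I -> {mpoly K[n]}) a :
  (forall i, lex_bounded (F i) a) -> lex_bounded (\sum_i F i) a.
Proof.
move=> Fa; elim/big_ind: _ => [|p q pa qa|i _].
- by move=> m; rewrite msupp0.
- by move=> m /msuppD_le; rewrite mem_cat => /orP[/pa|/qa].
- exact: Fa.
Qed.

Lemma lex_boundedM p q a b :
  lex_bounded p a -> lex_bounded q b -> lex_bounded (p * q) (a + b)%MM.
Proof.
move=> pa qb m /msuppM_le/allpairsP[[u v] /= [/pa ua /qb vb ->]].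
exact: lex_leD.
Qed.

Lemma mcoeffM_lex_bounded p q a b : lex_bounded p a -> lex_bounded q b ->
  (p * q)@_(a + b) = p@_a * q@_b.
Proof.
move=> pa qb; have coefE r c : r@_c = \sum_(u <- msupp r) r@_u * (u == c)%:R.
  rewrite {1}[r]mpolyE raddf_sum /=; apply: eq_bigr => u _.
  by rewrite mcoeffZ mcoeffX.
rewrite {1}[p]mpolyE {1}[q]mpolyE mulr_suml raddf_sum /=.
rewrite [p@_a]coefE mulr_suml; apply: eq_big_seq => u /pa ua.
rewrite mulr_sumr raddf_sum /= [q@_b]coefE mulr_sumr.
apply: eq_big_seq => v /qb vb.
rewrite -scalerAl -scalerAr -mpolyXD !mcoeffZ mcoeffX.
have -> : ((u + v)%MM == (a + b)%MM) = (u == a) && (v == b).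
  apply/eqP/andP => [/(lex_leD_eq ua vb)[-> ->] //|[/eqP-> /eqP->] //].
by case: eqP; case: eqP; rewrite /= ?mulr1 ?mulr0 ?mul0r ?mulr0.
Qed.

End LeadingMonomials.

(** * Derivations of a polynomial ring *)

Section Derivations.
Variables (K : fieldType) (n : nat).
Implicit Types (p q : {mpoly K[n]}).

(** The chain rule: both sides are K-linear, satisfy the Leibniz rule and agree on
    the variables. *)
Lemma mpoly_derivationE (D : {linear {mpoly K[n]} -> {mpoly K[n]}}) :
  (forall p q, D (p * q) = D p * q + p * D q) ->
  forall p, D p = \sum_l p^`M(l) * D 'X_l.
Proof.
move=> DM; have D1 : D 1 = 0.
  by apply: (addrI (D 1)); rewrite addr0 -{3}[1]mulr1 DM mulr1 mul1r.
pose T p := \sum_l p^`M(l) * D 'X_l.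
have TM p q : T (p * q) = T p * q + p * T q.
  rewrite /T mulr_suml mulr_sumr -big_split /=; apply: eq_bigr => l _.
  by rewrite mderivM mulrDl mulrA mulrAC.
have TX i : T 'X_i = D 'X_i.
  rewrite /T (bigD1 i) //= big1 => [|l li].
    rewrite mderivX mnm1E eqxx scale1r addr0.
    have -> : (U_(i) - U_(i))%MM = 0%MM :> 'X_{1..n}.
      by apply/mnmP => j; rewrite mnmBE subnn mnm0E.
    by rewrite mpolyX0 mul1r.
  by rewrite mderivX mnm1E eq_sym (negPf li) scale0r mul0r.
have T1 : T 1 = 0.
  by apply: big1 => l _; rewrite -mpolyC1 mderivC mul0r.
have DX m : D 'X_[m] = T 'X_[m].
  rewrite mpolyXE_id; elim/big_ind: _ => [|p q ep eq|i _]; first by rewrite D1 T1.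
    by rewrite DM TM ep eq.
  elim: (m i) => [|k IH]; first by rewrite expr0 D1 T1.
  by rewrite exprS DM TM IH TX.
move=> p; rewrite -/(T p) {1}[p]mpolyE raddf_sum /=.
have -> : T p = \sum_(m <- msupp p) p@_m *: T 'X_[m].
  rewrite {1}[p]mpolyE /T [RHS](eq_bigr _ (fun m _ => scaler_sumr _ _ _ _)) /=.
  rewrite exchange_big /=; apply: eq_bigr => l _.
  rewrite [X in X * _]raddf_sum /= mulr_suml; apply: eq_bigr => m _.
  by rewrite mderivZ scalerAl.
by apply: eq_bigr => m _; rewrite linearZ /= DX.
Qed.

(** Unlike the partial derivative, the Euler operator x_i d/dx_i is diagonal on
    monomials. *)
Lemma mcoeff_X_mderiv p i m : ('X_i * p^`M(i))@_m = p@_m *+ m i.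
Proof.
rewrite mulrC; case mi0: (m i) => [|k].
  rewrite mulr0n; apply: memN_msupp_eq0; apply/negP => /msuppM_le.
  move=> /allpairsP[[u v] /= [_ + em]]; rewrite msuppX inE => /eqP ev.
  by move: mi0; rewrite em ev mnmDE mnm1E eqxx addn1.
have em : ((m - U_(i)) + U_(i) = m)%MM.
  apply: submK; apply/mnm_lepP => j; rewrite mnm1E.
  by case: eqP => // <-; rewrite mi0.
have := mcoeffMX (p^`M(i)) U_(i) (m - U_(i)).
by rewrite addmC em mcoeff_mderiv em mnmBE mi0 mnm1E eqxx subn1.
Qed.

Lemma mderiv_nilpotent i p : exists N, iter N (mderiv i) p = 0.
Proof.
exists (msize p); rewrite -mderivn_iter mderivnE; apply: big1_seq => m /andP[_ mp].
rewrite ffact_small ?mul0r ?scale0r //.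
apply: leq_ltn_trans (msize_mdeg_lt mp).
by rewrite mdegE (bigD1 i) //= leq_addr.
Qed.

End Derivations.

(** * Leading monomials in the kernel of a locally nilpotent derivation *)

Section NilpotentDerivation.
Variables (K : fieldType) (n : nat) (s : 'S_n).
Hypothesis charK : [pchar K] =i pred0.
Variable D : {linear {mpoly K[n]} -> {mpoly K[n]}}.
Hypothesis DM : forall p q, D (p * q) = D p * q + p * D q.
Hypothesis Dnilp : forall p, exists N, iter N D p = 0.

(** With respect to the basis x_l d/dx_l of logarithmic derivations, the
    coefficients of x^u D, where x^u is the product of all variables, are the
    polynomials Q l.  The factor x^u keeps exponents nonnegative: the degree
    delta of the leading part of D may have an entry -1. *)
Let Q (l : 'I_n) := (\prod_(j | j != l) 'X_j) * D 'X_l.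
Let u : 'X_{1..n} := [multinom 1%N | j < n].

Lemma log_derivationE p : 'X_[u] * D p = \sum_l ('X_l * p^`M(l)) * Q l.
Proof.
rewrite (mpoly_derivationE DM) mulr_sumr; apply: eq_bigr => l _.
have -> : 'X_[u] = 'X_l * \prod_(j | j != l) 'X_j :> {mpoly K[n]}.
  rewrite mpolyXE_id (bigD1 l) //= mnmE; congr (_ * _).
  by apply: eq_bigr => j _; rewrite mnmE expr1.
rewrite /Q; set P := \prod_(j | _) _; ring.
Qed.

(** The vector c consists of the coefficients of the Q l at their largest
    monomial M, and w b is the product c . b.  The leading part of x^u D sends x^b to
    w b x^(b + M), so that D shifts leading exponents by M - u as long as w does
    not vanish on them, and w then grows by mu = w M - w u. *)
Lemma nilpotent_derivation_lead p a (l : 'I_n) :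
  D 'X_l != 0 -> D p = 0 -> lex_leads s p a -> exists i, a i = 0%N.
Proof.
move=> DXl Dp0 pa.
have Ql : Q l != 0.
  by rewrite mulf_neq0 //; apply/prodf_neq0 => j _; rewrite -msupp_eq0 msuppX.
pose r := flatten [seq msupp (Q j) | j <- enum 'I_n].
have in_r j m : m \in msupp (Q j) -> m \in r.
  by move=> mQ; apply/flatten_mapP; exists j; rewrite ?mem_enum.
have r0 : r != [::].
  apply/eqP => r0; move: (in_r l (mlead (Q l)) (mlead_supp Ql)).
  by rewrite r0.
pose M := \big[lex_max s/0%MM]_(m <- r) m.
pose c j := (Q j)@_M.
have QM j : lex_bounded s (Q j) M.
  by move=> m /in_r; apply: lex_bigmax_ge.
have [l1 cl1] : exists j, c j != 0.
  have /flatten_mapP[j _ Mj] := lex_bigmax_mem s r0.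
  by exists j; rewrite /c -mcoeff_msupp.
pose w (b : 'X_{1..n}) : K := \sum_j (b j)%:R * c j.
have wD b b' : w (b + b')%MM = w b + w b'.
  rewrite /w -big_split; apply: eq_bigr => j _ /=.
  by rewrite mnmDE natrD mulrDl.
have bounded (q : {mpoly K[n]}) b :
    lex_leads s q b -> forall j, lex_bounded s ('X_j * q^`M(j)) b.
  move=> [qb _] j m; rewrite mcoeff_msupp mcoeff_X_mderiv => m0; apply: qb.
  by rewrite mcoeff_msupp; apply: contraNneq m0 => ->; rewrite mul0rn.
have leadE (q : {mpoly K[n]}) b : lex_leads s q b -> ('X_[u] * D q)@_(b + M) = w b * q@_b.
  move=> qb; rewrite log_derivationE raddf_sum /= mulr_suml.
  apply: eq_bigr => j _; rewrite (mcoeffM_lex_bounded (bounded _ _ qb j) (QM j)).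
  by rewrite mcoeff_X_mderiv -/(c j) -[q@_b *+ _]mulr_natl mulrAC.
have lead_step (q : {mpoly K[n]}) b : lex_leads s q b -> w b != 0 ->
    exists2 b', lex_leads s (D q) b' & (u + b' = b + M)%MM.
  move=> qb wb.
  have uDq : lex_leads s ('X_[u] * D q) (b + M)%MM.
    split; last by rewrite leadE // mulf_neq0 //; case: qb.
    rewrite log_derivationE; apply: lex_bounded_sum => j.
    by apply: lex_boundedM (bounded _ _ qb j) (QM j).
  have Dq0 : D q != 0.
    by apply: contraTneq isT => Dq0; move: uDq.2; rewrite Dq0 mulr0 mcoeff0 eqxx.
  exists (lex_lead s (D q)); first exact: lex_leads_lead.
  have [Db Dc] := lex_leads_lead s Dq0.
  apply: (lex_leads_uniq _ uDq); split.
    by apply: lex_boundedM => //; apply: lex_boundedX.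
  rewrite (@mcoeffM_lex_bounded _ _ s) //; last exact: lex_boundedX.
  by rewrite mcoeffX eqxx mul1r.
(* Iterating D on q until it vanishes must meet an exponent at which w is 0. *)
pose mu := w M - w u.
have slope N (q : {mpoly K[n]}) b : lex_leads s q b -> iter N D q = 0 ->
    exists t : nat, w b + t%:R * mu = 0.
  elim: N q b => [|N IHN] q b qb.
    by move=> /= q0; move: qb.2; rewrite q0 mcoeff0 eqxx.
  rewrite iterSr => Nq; have [wb|wb] := eqVneq (w b) 0.
    by exists 0%N; rewrite wb mul0r addr0.
  have [b' Dqb' eb'] := lead_step q b qb wb.
  have [t et] := IHN _ _ Dqb' Nq; exists t.+1.
  have : w u + w b' = w b + w M by rewrite -!wD eb'.
  move: et; rewrite /mu -natr1 => + eb.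
  have -> : w b' = w b + w M - w u by rewrite -eb; ring.
  by move=> <-; ring.
have XlE j : lex_leads s ('X_j : {mpoly K[n]}) U_(j)%MM.
  by split; [apply: lex_boundedX | rewrite mcoeffX eqxx oner_neq0].
have wU j : w U_(j)%MM = c j.
  rewrite /w (bigD1 j) //= big1 ?mnm1E ?eqxx ?mul1r ?addr0 // => i ij.
  by rewrite mnm1E eq_sym (negPf ij) mul0r.
have /boolp.choice [t ct] : forall j, exists t : nat, c j = - (t%:R * mu).
  move=> j; have [N DN] := Dnilp 'X_j; have [t] := slope N _ _ (XlE j) DN.
  by rewrite wU => /eqP; rewrite addr_eq0 => /eqP ->; exists t.
have wa0 : w a = 0.
  have := leadE p a pa; rewrite Dp0 mulr0 mcoeff0 => /esym/eqP.
  by rewrite mulf_eq0 (negPf pa.2) orbF => /eqP.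
have mu0 : mu != 0.
  by apply: contraNneq cl1 => mu0; rewrite ct mu0 mulr0 oppr0.
have : (\sum_j a j * t j)%N%:R = 0 :> K.
  apply: (mulIf mu0); rewrite mul0r -[RHS]oppr0 -wa0 /w natr_sum mulr_suml -sumrN.
  by apply: eq_bigr => j _; rewrite ct natrM mulrN opprK mulrA.
move/eqP; rewrite ((pcharf0P K).1 charK) sum_nat_eq0 => /forallP/(_ l1).
rewrite muln_eq0 /= => /orP[/eqP al|/eqP tl]; first by exists l1.
by move: cl1; rewrite ct tl mul0r oppr0 eqxx.
Qed.

End NilpotentDerivation.

(** * Automorphisms of a polynomial ring *)

Section Automorphisms.
Variables (K : fieldType) (n : nat).
Hypothesis charK : [pchar K] =i pred0.
Variable Phi : {lrmorphism {mpoly K[n]} -> {mpoly K[n]}}.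
Variable Psi : {linear {mpoly K[n]} -> {mpoly K[n]}}.
Hypotheses (PhiK : cancel Phi Psi) (PsiK : cancel Psi Phi).

(** Partial differentiation in the coordinate system formed by the images of the
    variables under Phi. *)
Definition conj_mderiv j := Phi \o mderiv j \o Psi.

HB.instance Definition _ j := GRing.Linear.on (conj_mderiv j).

Lemma conj_mderivE j p : conj_mderiv j (Phi p) = Phi p^`M(j).
Proof. by rewrite /conj_mderiv /= PhiK. Qed.

Lemma conj_mderivM j p q :
  conj_mderiv j (p * q) = conj_mderiv j p * q + p * conj_mderiv j q.
Proof.
by rewrite -[p]PsiK -[q]PsiK -rmorphM !conj_mderivE mderivM rmorphD !rmorphM.
Qed.

Lemma conj_mderiv_nilpotent j p : exists N, iter N (conj_mderiv j) p = 0.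
Proof.
have [N DN] := mderiv_nilpotent j (Psi p); exists N.
rewrite -[p]PsiK (_ : iter _ _ _ = Phi (iter N (mderiv j) (Psi p))).
  by rewrite DN rmorph0.
by elim: N {DN} => //= N ->; rewrite conj_mderivE.
Qed.

Lemma conj_mderiv_Phi_var i j : conj_mderiv j (Phi 'X_i) = (i == j)%:R.
Proof.
rewrite conj_mderivE mderivX mnm1E; case: eqP => [->|_] /=.
  rewrite scale1r (_ : (_ - _)%MM = 0%MM) ?mpolyX0 ?rmorph1 //.
  by apply/mnmP => l; rewrite mnmBE subnn mnm0E.
by rewrite scale0r rmorph0.
Qed.

(** The image of x_i is a constant for the derivation along the image of another
    variable x_j. *)
Lemma automorphism_var_lead (s : 'S_n) (i j : 'I_n) a :
  i != j -> lex_leads s (Phi 'X_i) a -> exists l, a l = 0%N.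
Proof.
move=> ij; have [l Dl] : exists l, conj_mderiv j 'X_l != 0.
  case: (pickP (fun l => conj_mderiv j 'X_l != 0)) => [l|D0]; first by exists l.
  have := conj_mderiv_Phi_var j j; rewrite eqxx.
  rewrite (mpoly_derivationE (@conj_mderivM j)) big1 => [/esym/eqP|l _].
    by rewrite oner_eq0.
  by rewrite [X in _ * X](eqP (negbFE (D0 l))) mulr0.
apply: (nilpotent_derivation_lead charK (@conj_mderivM j) _ Dl).
  exact: conj_mderiv_nilpotent.
by rewrite [LHS]conj_mderiv_Phi_var (negPf ij).
Qed.

(** The derivation along Phi x_i kills the other variables, so by the chain rule
    it is g d/dx_i for some g, and its value 1 at Phi x_i makes d/dx_i (Phi x_i) a
    unit. *)
Lemma automorphism_fixing_vars (i : 'I_n) :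
  (forall j, j != i -> Phi 'X_j = 'X_j) ->
  exists2 c : K, c != 0 & (Phi 'X_i)^`M(i) = c%:MP.
Proof.
move=> Phi_fix; have : conj_mderiv i (Phi 'X_i) = 1.
  by rewrite conj_mderiv_Phi_var eqxx.
rewrite (mpoly_derivationE (@conj_mderivM i)) (bigD1 i) //= big1 => [|j ji].
  rewrite addr0 mulrC => /mpoly_intro_unit/andP[/eqP eqc].
  by rewrite unitfE; exists (mderiv i (Phi 'X_i))@_0.
by rewrite -(Phi_fix j ji) [X in _ * X]conj_mderiv_Phi_var (negPf ji) mulr0.
Qed.

End Automorphisms.

(** * Morphisms between quotient algebras *)

Section QuotientMorphisms.
Variables (K : fieldType) (A : comAlgType K).
Implicit Types (s t : seq A).

Lemma ideal_gen_mem s x : x \in s -> x \in ideal_gen s.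
Proof.
move=> /(nthP 0)[i lti <-]; apply/ideal_genP.
exists (fun j => (j == Ordinal lti)%:R); rewrite (bigD1 (Ordinal lti)) //=.
by rewrite eqxx mul1r big1 ?addr0 // => j /negPf ->; rewrite mul0r.
Qed.

Lemma quot_pi_monoid_morphism s : monoid_morphism (@quot_pi K A s).
Proof. by split=> // x y; rewrite pi_quotM. Qed.

Lemma quot_pi_zmod_morphism s : zmod_morphism (@quot_pi K A s).
Proof.
move=> x y; apply: (addIr (quot_pi s y)).
by rewrite -pi_quotD !subrK.
Qed.

HB.instance Definition _ s :=
  GRing.isZmodMorphism.Build A (quot_alg s) (@quot_pi K A s)
    (quot_pi_zmod_morphism s).
HB.instance Definition _ s :=
  GRing.isMonoidMorphism.Build A (quot_alg s) (@quot_pi K A s)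
    (quot_pi_monoid_morphism s).

Lemma quot_pi_eq0 s x : (quot_pi s x == 0) = (x \in ideal_gen s).
Proof.
rewrite -(rmorph0 (@quot_pi K A s)) -[x in RHS]subr0.
by apply/eqP/pi_quotP.
Qed.

Lemma quot_pi_gen s x : x \in s -> quot_pi s x = 0.
Proof. by move=> xs; apply/eqP; rewrite quot_pi_eq0 ideal_gen_mem. Qed.

Section Induced.
Variables (s t : seq A) (alpha : {lrmorphism A -> A}).
Hypothesis alpha_st : forall x, x \in s -> quot_pi t (alpha x) = 0.

(** The representative is an arbitrary choice; [quot_mapE] shows that the result
    does not depend on it. *)
Definition quot_map (u : quot_alg s) : quot_alg t :=
  quot_pi t (alpha (generic_quotient.repr u)).

Lemma quot_mapE x : quot_map (quot_pi s x) = quot_pi t (alpha x).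
Proof.
apply/eqP; rewrite -subr_eq0 -!rmorphB /=.
set y := generic_quotient.repr _; have /ideal_genP[c ->] : y - x \in ideal_gen s.
  by apply/pi_quotP; rewrite quot_piK.
rewrite !raddf_sum /= big1 // => i _.
by rewrite !rmorphM /= (alpha_st (mem_nth 0 (ltn_ord i))) mulr0.
Qed.

Lemma quot_map_zmod_morphism : zmod_morphism quot_map.
Proof.
elim/quot_piW => x; elim/quot_piW => y.
by rewrite -rmorphB !quot_mapE !rmorphB.
Qed.

Lemma quot_map_monoid_morphism : monoid_morphism quot_map.
Proof.
split=> [|]; first by rewrite -(rmorph1 (@quot_pi K A s)) quot_mapE !rmorph1.
elim/quot_piW => x; elim/quot_piW => y.
by rewrite -rmorphM !quot_mapE !rmorphM.
Qed.

Lemma quot_map_scalable : scalable quot_map.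
Proof.
move=> a; elim/quot_piW => x.
by rewrite -[a *: _]pi_quotZ !quot_mapE linearZ /= pi_quotZ.
Qed.

Definition quot_rmorphism : {rmorphism quot_alg s -> quot_alg t} :=
  HB.pack quot_map
    (GRing.isZmodMorphism.Build _ _ quot_map quot_map_zmod_morphism)
    (GRing.isMonoidMorphism.Build _ _ quot_map quot_map_monoid_morphism).

End Induced.

End QuotientMorphisms.

Section PolynomialQuotients.
Variables (K : fieldType) (n : nat).

Lemma quot_pi_mpoly_ext (s : seq {mpoly K[n]})
    (alpha beta : {lrmorphism {mpoly K[n]} -> {mpoly K[n]}}) :
  (forall i, quot_pi s (alpha 'X_i) = quot_pi s (beta 'X_i)) ->
  forall p, quot_pi s (alpha p) = quot_pi s (beta p).
Proof.
move=> eqX p; rewrite [p]mpolyE !raddf_sum /=; apply: eq_bigr => m _.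
rewrite !linearZ /= !pi_quotZ; congr (quot_scale _ _).
rewrite mpolyXE_id !rmorph_prod /=; apply: eq_bigr => i _.
by rewrite !rmorphXn /= eqX.
Qed.

Lemma comp_mpoly_fix (x1 : 'I_n) (lq : n.-tuple {mpoly K[n]}) p :
  (forall i, i != x1 -> tnth lq i = 'X_i) -> ~~ var_occurs x1 p ->
  p \mPo lq = p.
Proof.
move=> lqX /hasPn np; rewrite comp_mpolyEX [RHS]mpolyE.
apply: eq_big_seq => m /np; rewrite -leqNgt leqn0 => /eqP m0.
congr (_ *: _); rewrite comp_mpolyX mpolyXE_id; apply: eq_bigr => i _.
by have [->|/lqX -> //] := eqVneq i x1; rewrite m0 !expr0.
Qed.

End PolynomialQuotients.

(** * The obstruction to lifting *)

Section NonLifting.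
Variables (K : fieldType) (n : nat) (s : 'S_n).
Hypothesis charK : [pchar K] =i pred0.
Implicit Types (q : {mpoly K[n]}) (J : {pred {mpoly K[n]}}).

(** Divisibility of leading monomials transfers fullness from the basis to the
    whole ideal. *)
Lemma groebner_lead_full J G :
  is_groebner_basis s J G ->
  (forall g, g \in G -> forall i, (0 < lex_lead s g i)%N) ->
  forall q, q \in J -> q != 0 -> forall i, (0 < lex_lead s q i)%N.
Proof.
move=> [_ _ GJ] Gfull q qJ q0 i; have [g gG /mnm_lepP/(_ i)] := GJ q qJ q0.
by apply: leq_trans; apply: Gfull.
Qed.

(** For i <> x1, a nonzero difference Phi x_i - x_i would give Phi x_i a full
    leading monomial; so Phi moves x1 only, and d/dx1 (Phi x1) is constant.  This
    determines d/dx1 (Phi x1 - x1 ^ k), which is not compatible with a full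
    leading monomial of Phi x1 - x1 ^ k. *)
Lemma no_automorphism_congr_pow (x1 : 'I_n) k J
    (Phi : {lrmorphism {mpoly K[n]} -> {mpoly K[n]}}) :
  (2 <= n)%N -> (2 <= k)%N -> bijective Phi ->
  (forall q, q \in J -> q != 0 -> forall i, (0 < lex_lead s q i)%N) ->
  Phi 'X_x1 - 'X_x1 ^+ k \in J ->
  ~ (forall i, i != x1 -> Phi 'X_i - 'X_i \in J).
Proof.
move=> n2 k2 [Psi0 PhiK PsiK] Jfull J1 Ji.
have Psi_zmod := can2_zmod_morphism PhiK PsiK.
have Psi_scal := can2_scalable PhiK PsiK.
pose Psi : {linear {mpoly K[n]} -> {mpoly K[n]}} :=
  HB.pack Psi0 (GRing.isZmodMorphism.Build _ _ Psi0 Psi_zmod)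
    (GRing.isScalable.Build _ _ _ _ Psi0 Psi_scal).
have other (i : 'I_n) : exists j : 'I_n, i != j.
  pose j0 := Ordinal (ltnW n2); pose j1 := Ordinal n2.
  have [->|] := eqVneq i j0; last by exists j0.
  by exists j1; rewrite -val_eqE.
have Phi_fix i : i != x1 -> Phi 'X_i = 'X_i.
  move=> ix1; have := Ji i ix1; have [/eqP|r0 rJ] := eqVneq (Phi 'X_i - 'X_i) 0.
    by rewrite subr_eq0 => /eqP.
  set r := Phi 'X_i - 'X_i in r0 rJ.
  have full := Jfull r rJ r0; have [j ij] := other i.
  have [rb rc] := lex_leads_lead s r0; set a := lex_lead s r in full rb rc.
  (* A full monomial is a proper multiple of x_i, so it leads Phi x_i. *)
  have aU : U_(i)%MM != a.
    apply/eqP => /mnmP/(_ j); rewrite mnm1E (negPf ij) => a0.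
    by move: (full j); rewrite -a0.
  have Ua : lex_le s U_(i)%MM a.
    by apply/mnm_le_lex_le/mnm_lepP => l; rewrite mnm1E; case: eqP => // <-; apply: full.
  have FiE : Phi 'X_i = r + 'X_i by rewrite /r subrK.
  have [|l al] := @automorphism_var_lead _ _ charK Phi Psi PhiK PsiK s i j a ij.
    rewrite FiE; split; last by rewrite mcoeffD mcoeffX (negPf aU) addr0.
    move=> w /msuppD_le; rewrite mem_cat => /orP[/rb//|].
    by rewrite msuppX inE => /eqP ->.
  by move: (full l); rewrite al.
have [c c0 dE] := @automorphism_fixing_vars _ _ Phi Psi PhiK PsiK x1 Phi_fix.
(* The derivative of r at x1 involves no other variable, but that of its leading
   term contains all of them. *)
set r := Phi 'X_x1 - 'X_x1 ^+ k in J1.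
have XkE : ('X_x1 ^+ k : {mpoly K[n]}) = 'X_[U_(x1) *+ k] by rewrite mpolyXn.
have drE : r^`M(x1) = c%:MP - k%:R *: 'X_[U_(x1) *+ k.-1].
  rewrite /r mderivB dE XkE mderivX; congr (_ - _ *: 'X_[_]).
    by rewrite mulmnE mnm1E eqxx mul1n.
  apply/mnmP => j; rewrite mnmBE !mulmnE mnm1E.
  by case: eqP => _; rewrite ?mul1n ?subn1 ?mul0n.
have kE : k.-1.+1 = k by rewrite prednK // (ltnW k2).
have k0 : (k%:R : K) != 0 by rewrite ((pcharf0P K).1 charK) -kE.
have r0 : r != 0.
  apply/eqP => r0; move: drE; rewrite r0 mderiv0 => /(congr1 (mcoeff 0%MM)).
  rewrite mcoeff0 mcoeffB mcoeffC mcoeffZ mcoeffX eqxx mulr1.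
  have -> : ((U_(x1) *+ k.-1)%MM == 0%MM) = false.
    apply/negbTE/eqP => /mnmP/(_ x1); rewrite mulmnE mnm1E eqxx mul1n mnm0E.
    by move=> k1; move: k2; rewrite -kE k1.
  by rewrite mulr0 subr0 => /esym/eqP; rewrite (negPf c0).
have full := Jfull r J1 r0; have [_] := lex_leads_lead s r0.
set a := lex_lead s r in full *; have [j xj] := other x1.
have aE : (a - U_(x1) + U_(x1))%MM = a.
  by apply/submK/mnm_lepP => l; rewrite mnm1E; case: eqP => // <-; apply: full.
have bj : (a - U_(x1))%MM j = a j by rewrite mnmBE mnm1E (negPf xj) subn0.
have := congr1 (mcoeff (a - U_(x1))) drE.
rewrite mcoeff_mderiv aE mcoeffB mcoeffC mcoeffZ mcoeffX.
have -> : ((a - U_(x1))%MM == 0%MM) = false.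
  by apply/negbTE/eqP => /mnmP/(_ j); rewrite bj mnm0E => a0; move: (full j); rewrite a0.
have -> : ((U_(x1) *+ k.-1)%MM == (a - U_(x1))%MM) = false.
  apply/negbTE/eqP => /mnmP/(_ j); rewrite bj mulmnE mnm1E (negPf xj) => a0.
  by move: (full j); rewrite -a0.
rewrite !mulr0 subr0 -mulr_natr => /eqP; rewrite mulf_eq0 => /orP[/eqP->|].
  by rewrite eqxx.
by rewrite ((pcharf0P K).1 charK).
Qed.

End NonLifting.

(** * The isomorphism and its failure to lift *)

Theorem theorem1p1 (K : fieldType) (n m k : nat)
    (charK : [pchar K] =i pred0)
    (hn : (2 <= n)%N) (hm : (1 <= m)%N) (hk : (2 <= k)%N)
    (x1 : 'I_n) (hx1 : x1 = 0%N :> nat)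
    (f : {mpoly K[n]}) (hf : var_occurs x1 f)
    (p : nat -> {mpoly K[n]})
    (hp1 : p 1%N = 'X_x1 - subst_pow x1 k f)
    (hp : forall i : nat, (2 <= i <= m)%N -> ~~ var_occurs x1 (p i))
    (s : 'S_n) (G : seq {mpoly K[n]})
    (hG : is_reduced_groebner_basis s (ideal_gen [seq p i | i <- index_iota 1 m.+1]) G)
    (hlead : forall g : {mpoly K[n]}, g \in G ->
       forall i : 'I_n, (0 < lex_lead s g i)%N) :
  let I := ('X_x1 - f ^+ k) :: [seq p i | i <- index_iota 2 m.+1] in
  let J := [seq p i | i <- index_iota 1 m.+1] in
  exists phi : {rmorphism quot_alg I -> quot_alg J},
    [/\ alg_isomorphism phi,
        phi (quot_pi I 'X_x1) = quot_pi J ('X_x1 ^+ k),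
        forall i : 'I_n, i != x1 -> phi (quot_pi I 'X_i) = quot_pi J 'X_i
      & ~ lifts_to_automorphism phi].
Proof.
move=> I J.
(* The substitutions inducing the isomorphism and its inverse. *)
pose tpow := [tuple if j == x1 then 'X_j ^+ k else 'X_j : {mpoly K[n]} | j < n].
pose tf := [tuple if j == x1 then f else 'X_j | j < n].
pose alpha : {lrmorphism {mpoly K[n]} -> {mpoly K[n]}} := comp_mpoly tpow.
pose beta : {lrmorphism {mpoly K[n]} -> {mpoly K[n]}} := comp_mpoly tf.
have tpowX i : i != x1 -> tnth tpow i = 'X_i by rewrite tnth_mktuple => /negPf->.
have tfX i : i != x1 -> tnth tf i = 'X_i by rewrite tnth_mktuple => /negPf->.
have compX (t : n.-tuple {mpoly K[n]}) i : 'X_i \mPo t = tnth t i.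
  by rewrite comp_mpolyXU (tnth_nth 0).
have alpha1 : alpha 'X_x1 = 'X_x1 ^+ k.
  by rewrite [LHS]compX tnth_mktuple eqxx.
have beta1 : beta 'X_x1 = f by rewrite [LHS]compX tnth_mktuple eqxx.
have alphaX i : i != x1 -> alpha 'X_i = 'X_i by rewrite [alpha _]compX => /tpowX.
have betaX i : i != x1 -> beta 'X_i = 'X_i by rewrite [beta _]compX => /tfX.
have JE : J = ('X_x1 - alpha f) :: [seq p i | i <- index_iota 2 m.+1].
  have mE : (m.+1 - 1 = (m.+1 - 2).+1)%N by rewrite subSn ?subSS ?subn0 // subn1 prednK.
  by rewrite /J /index_iota mE /= hp1.
have tail_free q : q \in [seq p i | i <- index_iota 2 m.+1] -> ~~ var_occurs x1 q.
  by move=> /mapP[i + ->]; rewrite mem_index_iota ltnS => /hp.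
have I1 : quot_pi I 'X_x1 = quot_pi I (f ^+ k).
  by apply/pi_quotP/ideal_gen_mem; rewrite mem_head.
have J1 : quot_pi J 'X_x1 = quot_pi J (alpha f).
  by apply/pi_quotP/ideal_gen_mem; rewrite JE mem_head.
have beta_alpha q : quot_pi I (beta (alpha q)) = quot_pi I q.
  apply: (@quot_pi_mpoly_ext _ _ I (beta \o alpha) idfun) => i /=.
  have [->|ix1] := eqVneq i x1; last by rewrite alphaX ?betaX.
  by rewrite alpha1 rmorphXn /= beta1 I1.
have alpha_beta q : quot_pi J (alpha (beta q)) = quot_pi J q.
  apply: (@quot_pi_mpoly_ext _ _ J (alpha \o beta) idfun) => i /=.
  have [->|ix1] := eqVneq i x1; last by rewrite betaX ?alphaX.
  by rewrite beta1 J1.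
have alphaIJ q : q \in I -> quot_pi J (alpha q) = 0.
  rewrite inE => /predU1P[->|qp].
    by rewrite !rmorphB /= alpha1 !rmorphXn /= J1 subrr.
  rewrite [alpha q](comp_mpoly_fix tpowX) ?tail_free //.
  by apply: quot_pi_gen; rewrite JE inE qp orbT.
have betaJI q : q \in J -> quot_pi I (beta q) = 0.
  rewrite JE inE => /predU1P[->|qp].
    by rewrite !rmorphB /= beta1 beta_alpha subrr.
  rewrite [beta q](comp_mpoly_fix tfX) ?tail_free //.
  by apply: quot_pi_gen; rewrite inE qp orbT.
pose phi := quot_rmorphism alphaIJ; pose psi := quot_rmorphism betaJI.
have phiE q : phi (quot_pi I q) = quot_pi J (alpha q) by apply: quot_mapE.
have psiE q : psi (quot_pi J q) = quot_pi I (beta q) by apply: quot_mapE.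
exists phi; split.
- split; first exact: quot_map_scalable.
  exists psi; elim/quot_piW => q.
    by rewrite phiE psiE beta_alpha.
  by rewrite psiE phiE alpha_beta.
- by rewrite phiE alpha1.
- by move=> i ix1; rewrite phiE alphaX.
move=> [Phi [Phi_bij PhiE]].
have [groebnerG _ _] := hG.
have Jfull := groebner_lead_full groebnerG hlead.
apply: (@no_automorphism_congr_pow _ _ _ charK x1 _ _ _ hn hk Phi_bij Jfull).
  by apply/pi_quotP; rewrite PhiE phiE alpha1.
by move=> i ix1; apply/pi_quotP; rewrite PhiE phiE alphaX.
Qed.
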